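(* Let $\mathcal{C}$ be the class of all finite cyclic groups. The set $$\operatorname{Im}\psi''|_{\mathcal{C}}=\lbrace \psi''(G)\mid G\in\mathcal{C}\rbrace$$ is dense in $[0,1]$.
   Context: For a finite group $G$ and $x\in G$, $o(x)$ denotes the order of $x$. The sum of element orders of $G$ is $\psi(G)=\sum_{x\in G}o(x)$, and $\psi''(G)=\frac{\psi(G)}{|G|^2}$. One has $\psi''(G)\in(0,1]$ for every finite group $G$. $\psi''|_{\mathcal{C}}$ is the restriction of $\psi''$ to the class $\mathcal{C}$. Density in $[0,1]$ is with respect to the usual topology of $\mathbb{R}$, i.e. the closure of the set is $[0,1]$. *)

(* Defs.v *)
From HB Require Import structures.
From mathcomp Require Import all_boot all_order all_algebra all_fingroup all_solvable.
From mathcomp Require Import all_classical all_reals all_analysis.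

Set Implicit Arguments.
Unset Strict Implicit.
Unset Printing Implicit Defensive.

Import Order.TTheory GRing.Theory Num.Theory.
Import numFieldNormedType.Exports.

Local Open Scope ring_scope.
Local Open Scope classical_set_scope.

Definition psi (gT : finGroupType) (G : {group gT}) : nat :=
  (\sum_(x in G) #[x]%g)%N.

Definition psi'' (R : realType) (gT : finGroupType) (G : {group gT}) : R :=
  (psi G)%:R / #|G|%:R ^+ 2.

(* A finite group is a subgroup G of an ambient finite group gT; since gT
   ranges over all finite group types, every finite group arises this way,
   up to isomorphism. *)
Definition finite_group_class : Type :=
  forall gT : finGroupType, {group gT} -> Prop.

Definition cyclic_groups : finite_group_class :=
  fun gT (G : {group gT}) => cyclic G.

Definition im_psi'' (R : realType) (C : finite_group_class) : set R :=
  [set y : R | exists (gT : finGroupType) (G : {group gT}),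
    C gT G /\ psi'' R G = y].

Arguments im_psi'' R C : clear implicits.

(* Main.v *)
(* psi'' is multiplicative on products of groups of coprime orders, so the cyclic
   group of squarefree order n has psi'' equal to the product of the factors
   1 - 1/p + 1/p^2 over the primes p dividing n.  The product over all primes
   p >= K is 0, because the sum of the 1/p diverges, while each factor is at
   least 1 - 1/K.  Hence the partial products go from 1 to 0 in steps of length
   at most 1/K, and come within 1/K of every point of [0, 1]. *)

Require Import Defs.
From mathcomp Require Import all_boot all_order all_algebra all_fingroup all_solvable.
From mathcomp Require Import all_classical all_reals all_analysis.
From mathcomp Require Import ring lra zify.

Import Order.TTheory GRing.Theory Num.Theory.
Import numFieldNormedType.Exports.

Local Open Scope ring_scope.

Lemma big_nat_recr_cond (T : Type) (idx : T) (op : Monoid.law idx) (m n : nat)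
    (P : pred nat) (F : nat -> T) : (m <= n)%N ->
  \big[op/idx]_(m <= i < n.+1 | P i) F i =
  op (\big[op/idx]_(m <= i < n | P i) F i) (if P n then F n else idx).
Proof. by move=> lemn; rewrite big_mkcond big_nat_recr //= -big_mkcond. Qed.

(** * Divergence of the sum of the reciprocals of the primes *)

Definition smooth (K n : nat) : bool := all (fun p => (p < K)%N) (primes n).

(** Induction on [n], removing its least prime factor [p]: if [p] is already in [S], both copies of
    [p] move into the square, otherwise [p] joins [S]. Taking [S] inside ['I_K] leaves only [2 ^ K]
    choices for it. *)
Lemma smooth_squarefree_square (K n : nat) : (0 < n)%N -> smooth K n ->
  exists (S : {set 'I_K}) (m : nat), n = ((\prod_(p in S) p) * m ^ 2)%N.
Proof.
elim/ltn_ind: n => n IHn n_gt0 smn.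
have [n1|n_gt1] := leqP n 1.
  exists finset.set0, 1%N; rewrite big_set0; lia.
have pp := pdiv_prime n_gt1; have dv := pdiv_dvd n.
have ltpK : (pdiv n < K)%N.
  by apply: (allP smn); rewrite mem_primes pp n_gt0 dv.
set p := pdiv n in pp dv ltpK *.
have nE := divnK dv; set k := (n %/ p)%N in nE.
have k_gt0 : (0 < k)%N by move: n_gt0; rewrite -nE muln_gt0 => /andP[].
have smk : smooth K k.
  apply/allP => q; rewrite mem_primes => /and3P[pq _ qk].
  by apply: (allP smn); rewrite mem_primes pq n_gt0 -nE dvdn_mulr.
have ltkn : (k < n)%N by rewrite -nE ltn_Pmulr ?prime_gt1.
have [S [m kE]] := IHn k ltkn k_gt0 smk.
pose i := Ordinal ltpK.
have [iS|iS] := boolP (i \in S).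
  exists (S :\ i)%SET, (m * p)%N; rewrite -nE kE (big_setD1 i) //=; ring.
exists (i |: S)%SET, m; rewrite -nE kE big_setU1 //=; ring.
Qed.

(** A smooth [n <= M ^ 2] is determined by its pair [(S, m)], and [m ^ 2 <= n] forces [m <= M]. *)
Lemma count_smooth (K M : nat) :
  (\sum_(1 <= n < (M ^ 2).+1) smooth K n <= 2 ^ K * M)%N.
Proof.
rewrite -big_mkcond sum1_count -size_filter.
(* The successor makes ['I_M] index the values 1 to [M] of [m]. *)
pose f (x : {set 'I_K} * 'I_M) := ((\prod_(p in x.1) p) * x.2.+1 ^ 2)%N.
pose s := map f (enum {: {set 'I_K} * 'I_M}).
have <- : size s = (2 ^ K * M)%N.
  by rewrite size_map -cardE card_prod -(cardsT {set _}) -powersetT card_powerset cardsT !card_ord.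
apply: uniq_leq_size => [|n]; first by rewrite filter_uniq ?iota_uniq.
rewrite mem_filter mem_index_iota => /and3P[smn n_gt0 leM].
have [S [m nE]] := smooth_squarefree_square K n n_gt0 smn.
move: n_gt0 leM; rewrite nE muln_gt0 expn_gt0 orbF => /andP[P_gt0 m_gt0].
rewrite ltnS => /(leq_trans (leq_pmull _ P_gt0)); rewrite leq_exp2r // => leM.
have ltM : (m.-1 < M)%N by rewrite prednK.
apply/mapP; exists (S, Ordinal ltM); first by rewrite mem_enum.
by rewrite /f /= prednK.
Qed.

(* Erdos's argument: at most half of the integers up to [4 ^ K.+1] are
   [K]-smooth, and the others are multiples of a prime [p >= K]. *)
Lemma sum_inv_prime_ge_half (R : realFieldType) (K : nat) :
  2^-1 <= \sum_(K <= p < (4 ^ K.+1).+1 | prime p) p%:R^-1 :> R.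
Proof.
set N := (4 ^ K.+1)%N.
(* With [M = 2 ^ K.+1] in [count_smooth], the bound [2 ^ K * M] is exactly half of [N = M ^ 2]. *)
have NE : N = ((2 ^ K.+1) ^ 2)%N by rewrite /N -expnM mulnC expnM.
have half : (N <= 2 * \sum_(K <= p < N.+1 | prime p) N %/ p)%N.
  suff : (N <= 2 ^ K * 2 ^ K.+1 + \sum_(K <= p < N.+1 | prime p) N %/ p)%N.
    have -> : N = (2 * (2 ^ K * 2 ^ K.+1))%N by rewrite NE (expnS 2 K); ring.
    lia.
  rewrite (leq_trans _ (leq_add (count_smooth K _) (leqnn _))) // -NE.
  under [X in (_ <= _ + X)%N]eq_bigr do rewrite divn_count_dvd.
  (* [N %/ p] counts the multiples of [p] up to [N]. After the exchange it suffices that each [n] is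
     counted at least once, as smooth or through a prime divisor [p >= K]. *)
  rewrite exchange_big -big_split /=.
  have NS : N = (\sum_(1 <= n < N.+1) 1)%N by rewrite sum_nat_const_nat; lia.
  rewrite [X in (X <= _)%N]NS.
  rewrite big_seq [X in (_ <= X)%N]big_seq leq_sum // => n.
  rewrite mem_index_iota => /andP[n_gt0 ltnN].
  have [//|/allPn[p]] := boolP (smooth K n).
  rewrite mem_primes -leqNgt => /and3P[pp _ pn] leKp.
  rewrite (big_rem p) ?pp ?pn //=.
  by rewrite mem_index_iota leKp (leq_ltn_trans (dvdn_leq _ pn)).
have N_gt0 : 0 < N%:R :> R by rewrite ltr0n expn_gt0.
rewrite -(ler_pM2l N_gt0) ler_pdivrMr // mulr_sumr.
move: half; rewrite -(ler_nat R) natrM mulrC => /le_trans; apply.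
rewrite ler_pM2r // natr_sum; apply: ler_sum => p pp.
by rewrite ler_pdivlMr ?ltr0n ?prime_gt0 // -natrM ler_nat leq_divM.
Qed.

(** * Multiplicativity of [psi''], and cyclic groups of squarefree order *)

Lemma order_pair (gT hT : finGroupType) (x : gT) (y : hT) :
  coprime #[x]%g #[y]%g -> #[(x, y)]%g = (#[x]%g * #[y]%g)%N.
Proof.
move=> co_xy.
pose a : (gT * hT)%type := (x, 1%g); pose b : (gT * hT)%type := (1%g, y).
have oa : #[a]%g = #[x]%g.
  exact: (order_injm (injm_pairg1 gT hT) (finset.in_setT x)).
have ob : #[b]%g = #[y]%g.
  exact: (order_injm (injm_pair1g gT hT) (finset.in_setT y)).
have ab : (a * b)%g = (x, y) by congr pair; rewrite /= ?mulg1 ?mul1g.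
have ba : (b * a)%g = (x, y) by congr pair; rewrite /= ?mulg1 ?mul1g.
by rewrite -ab orderM ?oa ?ob // /commute ab ba.
Qed.

Lemma cyclic_setX_group (gT hT : finGroupType) (G : {group gT}) (H : {group hT}) :
  cyclic G -> cyclic H -> coprime #|G| #|H| -> cyclic (setX_group G H).
Proof.
move=> /cyclicP[x Gx] /cyclicP[y Hy] coGH.
apply/cyclicP; exists (x, y); apply/eqP; rewrite eq_sym eqEcard.
rewrite cycle_subG /= finset.in_setX Gx Hy !cycle_id /= cardsX -!orderE order_pair //.
by rewrite !orderE -Gx -Hy.
Qed.

Lemma psi_setX_group (gT hT : finGroupType) (G : {group gT}) (H : {group hT}) :
  coprime #|G| #|H| -> psi (setX_group G H) = (psi G * psi H)%N.
Proof.
move=> coGH; rewrite /psi big_distrlr /= pair_big /=.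
apply: eq_big => [[x y]|[x y]]; rewrite inE //= => /andP[Gx Hy].
rewrite order_pair //.
by rewrite (coprime_dvdl _ (coprime_dvdr _ coGH)) ?order_dvdG.
Qed.

Lemma psi''_setX_group (R : realType) (gT hT : finGroupType)
    (G : {group gT}) (H : {group hT}) :
  coprime #|G| #|H| -> psi'' R (setX_group G H) = psi'' R G * psi'' R H.
Proof.
move=> coGH.
by rewrite /psi'' psi_setX_group // cardsX !natrM exprMn invfM mulrACA.
Qed.

Definition psi''_prime (R : realType) (p : nat) : R :=
  1 - p%:R^-1 + p%:R^-1 ^+ 2.

(** Besides the identity, all [#|G| - 1] elements have order [#|G|]. *)
Lemma psi''_card_prime (R : realType) (gT : finGroupType) (G : {group gT}) :
  prime #|G| -> psi'' R G = psi''_prime R #|G|.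
Proof.
move=> pG; have p_gt0 := prime_gt0 pG.
have -> : psi'' R G = (1 + (#|G|%:R - 1) * #|G|%:R) / #|G|%:R ^+ 2.
  rewrite /psi''; congr (_ / _).
  have -> : psi G = (1 + #|G|.-1 * #|G|)%N.
    rewrite /psi (bigD1 1%g) //= order1; congr addn.
    rewrite (eq_bigr (fun=> #|G|)) => [|x /andP[Gx nx1]].
      rewrite sum_nat_const; congr muln.
      rewrite (cardsD1 1%g G) group1 /=.
      by apply: eq_card => x; rewrite finset.in_setD1 unfold_in andbC.
    by apply/(prime_nt_dvdP pG); rewrite ?order_eq1 ?order_dvdG.
  by rewrite natrD natrM -subn1 natrB.
have : #|G|%:R != 0 :> R by rewrite pnatr_eq0 -lt0n.
by rewrite /psi''_prime => nz; field.
Qed.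

Lemma cyclic_psi''_prod (R : realType) (K n : nat) : (K <= n)%N ->
  im_psi'' R cyclic_groups (\prod_(K <= p < n | prime p) psi''_prime R p).
Proof.
move=> leKn.
(* The order of [G] is carried through the induction because it yields the coprimality with the next
   prime. *)
suff [gT [G [cG _ <-]]] : exists (gT : finGroupType) (G : {group gT}),
    [/\ cyclic G, #|G| = (\prod_(K <= p < n | prime p) p)%N
      & psi'' R G = \prod_(K <= p < n | prime p) psi''_prime R p].
  by exists gT, G.
rewrite -(subnKC leKn); move: (n - K)%N => {leKn}n.
elim: n => [|d [gT [G [cG oG eG]]]].
  exists 'Z_2, 1%G; rewrite addn0 !big_geq // cards1 cyclic1; split=> //.
  by rewrite /psi'' /psi big_set1 order1 cards1 expr1n divr1.
rewrite addnS !big_nat_recr_cond ?leq_addr //=.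
move: (K + d)%N oG eG => n oG eG.
case: ifP => [pn|_]; last by exists gT, G; rewrite muln1 mulr1.
have [hT [H oH]] : exists (hT : finGroupType) (H : {group hT}), #|H| = n.
  by exists 'Z_n, [set: 'Z_n]%G; rewrite /= cardsT card_ord Zp_cast ?prime_gt1.
have pH : prime #|H| by rewrite oH.
have co : coprime #|G| #|H|.
  rewrite oH oG coprime_sym big_nat_cond.
  apply: (big_ind (coprime n)) => [|a b|p /andP[/andP[_ ltpn] pp]].
  - exact: coprimen1.
  - by rewrite coprimeMr => -> ->.
  - by rewrite prime_coprime // dvdn_prime2 // neq_ltn ltpn orbT.
exists (gT * hT)%type, (setX_group G H); split.
- by exact: cyclic_setX_group cG (prime_cyclic pH) co.
- by rewrite /= cardsX oG oH.
- by rewrite psi''_setX_group // eG psi''_card_prime // oH.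
Qed.

(** * Bounds on products of [psi''_prime] *)

Lemma psi''_prime_ge0 (R : realType) (p : nat) : 0 <= psi''_prime R p.
Proof. rewrite /psi''_prime; nra. Qed.

Lemma psi''_prime_itv (R : realType) (p : nat) :
  prime p -> 1 - p%:R^-1 <= psi''_prime R p <= 1.
Proof.
move=> pp; have : p%:R^-1 <= 1 :> R by rewrite invf_le1 ?ler1n ?ltr0n prime_gt0.
have : 0 <= p%:R^-1 :> R by rewrite invr_ge0.
rewrite /psi''_prime; nra.
Qed.

(** Each factor is at most [1 / (1 + x / 2)] with [x = 1 / p], so the product [P] and the sum [S] of
    the reciprocals satisfy [P * (1 + S / 2) <= 1]. Since [S >= 1 / 2], this gives [P <= 4 / 5]. *)
Lemma prod_psi''_prime_le_4_5 (R : realType) (K : nat) : exists2 n : nat,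
  (K <= n)%N & \prod_(K <= p < n | prime p) psi''_prime R p <= 4 / 5.
Proof.
exists (4 ^ K.+1).+1.
  rewrite (leq_trans (ltnW (ltn_expl K (isT : 1 < 4)%N))) // leqW //.
  by rewrite leq_exp2l.
have := sum_inv_prime_ge_half R K.
set S := \sum_(_ <= _ < _ | _) _; set P := \prod_(_ <= _ < _ | _) _ => leS.
have : [/\ 0 <= P, 0 <= S & P * (1 + S / 2) <= 1]; last by case; nra.
rewrite /P /S.
apply: (big_rec2 (fun a b => [/\ 0 <= a, 0 <= b & a * (1 + b / 2) <= 1])).
  by split; lra.
move=> p a b pp [a0 b0 ab].
have x2 : p%:R^-1 <= 2^-1 :> R.
  by rewrite lef_pV2 ?posrE ?ltr0n ?prime_gt0 // ler_nat prime_gt1.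
have x0 : 0 <= p%:R^-1 :> R by rewrite invr_ge0.
split; [by rewrite mulr_ge0 ?psi''_prime_ge0 | exact: addr_ge0 |].
(* For [x = 1 / p] the left side is [1 - (x / 2) * (1 - x - x ^ 2)], and [x <= 1 / 2] makes the last
   bracket positive. *)
have f1 : psi''_prime R p * (1 + p%:R^-1 / 2) <= 1 by rewrite /psi''_prime; nra.
have f0 := psi''_prime_ge0 R p.
have : psi''_prime R p * (1 + p%:R^-1 / 2) * (a * (1 + b / 2)) <= 1.
  by rewrite mulr_ile1 // !mulr_ge0 // addr_ge0 ?mulr_ge0.
have : 0 <= psi''_prime R p * a * (p%:R^-1 * b) by rewrite !mulr_ge0.
lra.
Qed.

Local Open Scope classical_set_scope.

(** Concatenating [m] consecutive blocks, each with product at most [4 / 5], brings the product down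
    to [(4 / 5) ^+ m]. *)
Lemma prod_psi''_prime_small (R : realType) (K : nat) (e : R) : 0 < e ->
  exists2 n : nat,
    (K <= n)%N & \prod_(K <= p < n | prime p) psi''_prime R p < e.
Proof.
move=> e_gt0.
have [m lte] : exists m, (4 / 5) ^+ m < e.
  have /cvgrPdist_lt /(_ e e_gt0) [m _ /(_ m (leqnn m))] :
      (fun n => (4 / 5 : R) ^+ n) @ \oo --> (0 : R).
    by apply: cvg_expr; rewrite ger0_norm; lra.
  by rewrite /= sub0r normrN ger0_norm ?exprn_ge0 ?divr_ge0 // => ?; exists m.
suff [n leKn le] : exists2 n, (K <= n)%N &
    \prod_(K <= p < n | prime p) psi''_prime R p <= (4 / 5) ^+ m.
  by exists n => //; apply: le_lt_trans lte.
elim: m {lte} => [|m [n leKn IH]]; first by exists K; rewrite ?big_geq.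
have [k lenk le] := prod_psi''_prime_le_4_5 R n.
exists k; first exact: leq_trans lenk.
rewrite (big_cat_nat leKn) //= exprSr ler_pM //.
- by apply: prodr_ge0 => p _; apply: psi''_prime_ge0.
- by apply: prodr_ge0 => p _; apply: psi''_prime_ge0.
Qed.

Lemma psi''_itv (R : realType) (gT : finGroupType) (G : {group gT}) :
  0 <= psi'' R G <= 1.
Proof.
rewrite /psi'' divr_ge0 ?exprn_ge0 //=.
rewrite ler_pdivrMr ?exprn_gt0 ?ltr0n // mul1r -natrX ler_nat.
rewrite /psi -mulnn -sum_nat_const leq_sum // => x Gx.
by rewrite dvdn_leq // order_dvdG.
Qed.

Theorem corollary1p2 (R : realType) :
  closure (im_psi'' R cyclic_groups) = `[(0 : R), 1].
Proof.
apply/seteqP; split.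
  rewrite [X in _ `<=` X](closure_id _).1; last exact: interval_closed.
  apply: closure_subset => _ [gT [G [_ <-]]] /=.
  by rewrite in_itv /= psi''_itv.
move=> y /=; rewrite in_itv /= => /andP[y_ge0 y_le1] B.
move=> /nbhs_ballP[e /= e_gt0 yB].
pose K := (Num.truncn e^-1).+1.
have K_gt0 : 0 < K%:R :> R by rewrite ltr0n.
have Ke : K%:R^-1 < e.
  by rewrite invf_plt ?posrE // truncnS_gt.
pose v n : R := \prod_(K <= p < n | prime p) psi''_prime R p.
(* The threshold is [y + e] rather than [y] so that it is positive even when [y = 0]; the witness is
   the first [v n] below it. *)
have ye_gt0 : 0 < y + e by lra.
have [n0 leKn0 ltn0] := prod_psi''_prime_small R K _ ye_gt0.
have exn : exists n, (K <= n)%N && (v n < y + e) by exists n0; rewrite leKn0.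
have [n /andP[leKn ltv] minn] := ex_minnP exn.
exists (v n); split; first exact: cyclic_psi''_prod.
apply: yB; rewrite /ball /= ltr_norml.
suff : y - e < v n by move=> ?; apply/andP; split; lra.
(* If [n <= K] the product is empty, so [v n = 1], which is at least [y]. *)
have [nK|ltKn] := leqP n K.
  by rewrite /v big_geq //; lra.
have [m nE] : exists m, n = m.+1.
  by exists n.-1; rewrite prednK // (leq_trans _ ltKn).
rewrite nE in ltKn minn *; rewrite ltnS in ltKn.
(* By minimality of [n], the previous product has not yet passed the threshold; one step lowers it
   by at most [1 / K < e], so [v n] stays above [y]. *)
have vm : y + e <= v m.
  rewrite leNgt; apply/negP => vm.
  by have := minn m; rewrite ltKn vm ltnn => /(_ isT).
have /andP[v0 v1] : 0 <= v m <= 1.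
  apply: (big_ind (fun x => 0 <= x <= 1)) => [|a b /andP[? ?] /andP[? ?]|p pp].
  - lra.
  - by rewrite mulr_ge0 ?mulr_ile1.
  - by rewrite psi''_prime_ge0; have /andP[] := psi''_prime_itv R p pp.
suff : v m - K%:R^-1 <= v m.+1 by lra.
have K1 : 0 <= K%:R^-1 :> R by rewrite invr_ge0.
rewrite {2}/v big_nat_recr_cond //= -/(v m).
case: ifP => [pm|_]; last by lra.
have /andP[fm _] := psi''_prime_itv R m pm.
have mK : m%:R^-1 <= K%:R^-1 :> R.
  by rewrite lef_pV2 ?posrE ?ltr0n ?ler_nat ?(leq_trans _ ltKn).
have := ler_wpM2l v0 fm.
have : v m * m%:R^-1 <= m%:R^-1 by rewrite ler_piMl ?invr_ge0.
lra.
Qed.
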